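(* Let $d\ge1$ be an integer. For every $a\in[0,1]$ and every $\sigma\in\mathcal{D}(\mathbb{C}^d)$, the Holevo capacity of the channel $\mathcal{E}_{a,\sigma}$ satisfies $$\chi(\mathcal{E}_{a,\sigma})\ \le\ \log d-(1-a)H(\sigma).$$
   Context: $\mathcal{D}(\mathbb{C}^d)$ is the set of $d\times d$ complex positive semidefinite matrices of trace $1$. $\log$ is the natural logarithm, and $H(\rho):=-\operatorname{Tr}(\rho\log\rho)$ is the von Neumann entropy ($0\log0:=0$). For fixed $a\in[0,1]$ and $\sigma\in\mathcal{D}(\mathbb{C}^d)$, the channel $\mathcal{E}_{a,\sigma}:\mathcal{D}(\mathbb{C}^d)\to\mathcal{D}(\mathbb{C}^d)$ is $$\mathcal{E}_{a,\sigma}(\rho):=a\rho+(1-a)\sigma-\sqrt{a(1-a)}\;i[\rho,\sigma],\qquad [\rho,\sigma]:=\rho\sigma-\sigma\rho .$$ It equals $\operatorname{Tr}_2\big(U_a(\rho\otimes\sigma)U_a^\dagger\big)$, where $U_a=\sqrt a\,I+i\sqrt{1-a}\,S$ and $S$ is the swap operator on $\mathbb{C}^d\otimes\mathbb{C}^d$, so its output is a density matrix. The Holevo capacity of a channel $\mathcal{E}$ on $\mathcal{D}(\mathbb{C}^d)$ is $$\chi(\mathcal{E}):=\max_{\{p_i,\rho_i\}}\Big\{H\Big(\sum_ip_i\mathcal{E}(\rho_i)\Big)-\sum_ip_iH(\mathcal{E}(\rho_i))\Big\},$$ the maximum (supremum) being over all finite ensembles of states $\rho_i\in\mathcal{D}(\mathbb{C}^d)$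 with probabilities $p_i$. *)

(* Defs.v *)
From HB Require Import structures.
From mathcomp Require Import all_boot all_order all_algebra.
From mathcomp Require Import complex.
From mathcomp Require Import boolp classical_sets reals constructive_ereal ereal.
From mathcomp Require Import exp.

Set Implicit Arguments.
Unset Strict Implicit.
Unset Printing Implicit Defensive.

Import Order.TTheory GRing.Theory Num.Theory.

Local Open Scope ring_scope.
Local Open Scope complex_scope.
Local Open Scope sesquilinear_scope.
Local Open Scope classical_set_scope.

(* In the order of [R[i]], [0 <= z] means that [z] is real and nonnegative. *)
Definition psdmx (R : realType) (d : nat) (A : 'M[R[i]]_d) : Prop :=
  A \is hermsymmx /\ forall v : 'cV[R[i]]_d, 0 <= (v^t* *m A *m v) 0 0.

Definition density (R : realType) (d : nat) : set 'M[R[i]]_d :=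
  [set A | psdmx A /\ \tr A = 1].

(* Functional calculus: for a Hermitian matrix, [A] is
   [invmx P *m diag_mx (spectral_diag A) *m P] with [P := spectralmx A] unitary
   and [spectral_diag A] real ([orthomx_spectralP],
   [hermitian_spectral_diag_real]). Since [ln 0 = 0], the zero eigenvalues of
   [A] are sent to [0]. *)
Definition lnmx (R : realType) (d : nat) (A : 'M[R[i]]_d) : 'M[R[i]]_d :=
  invmx (spectralmx A)
    *m diag_mx (map_mx (fun z : R[i] => (ln (complex.Re z))%:C) (spectral_diag A))
    *m spectralmx A.

(* The trace is real for Hermitian [A]. The convention [0 log 0 = 0] holds
   because [lnmx] vanishes on the kernel of [A]. *)
Definition entropy (R : realType) (d : nat) (A : 'M[R[i]]_d) : R :=
  - complex.Re (\tr (A *m lnmx A)).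

Definition commutator (R : realType) (d : nat) (A B : 'M[R[i]]_d) : 'M[R[i]]_d :=
  A *m B - B *m A.

Definition partial_swap (R : realType) (d : nat) (a : R) (sigma rho : 'M[R[i]]_d) :
    'M[R[i]]_d :=
  a%:C *: rho + (1 - a)%:C *: sigma
    - ((Num.sqrt (a * (1 - a)))%:C * 'i%C) *: commutator rho sigma.

Definition ensemble (R : realType) (d n : nat)
    (p : 'I_n -> R) (rho : 'I_n -> 'M[R[i]]_d) : Prop :=
  [/\ forall i, 0 <= p i, \sum_(i < n) p i = 1 & forall i, density (rho i)].

Definition holevo_quantity (R : realType) (d n : nat) (E : 'M[R[i]]_d -> 'M[R[i]]_d)
    (p : 'I_n -> R) (rho : 'I_n -> 'M[R[i]]_d) : R :=
  entropy (\sum_(i < n) (p i)%:C *: E (rho i))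
    - \sum_(i < n) p i * entropy (E (rho i)).

(* The supremum is taken in [\bar R], where it always exists. Only the values of
   [E] on [density] matter. *)
Definition holevo_capacity (R : realType) (d : nat) (E : 'M[R[i]]_d -> 'M[R[i]]_d) :
    \bar R :=
  ereal_sup [set x | exists n (p : 'I_n -> R) (rho : 'I_n -> 'M[R[i]]_d),
    ensemble p rho /\ x = (holevo_quantity E p rho)%:E].

(* Main.v *)
Require Import Defs.
From mathcomp Require Import all_boot all_order all_algebra.
From mathcomp Require Import complex reals constructive_ereal exp.
From mathcomp Require Import ereal ring lra.

(* With [K = sqrt a rho + i sqrt (1 - a)] the output of the channel is
     [E(rho) = K sigma K^* + a (rho - rho sigma rho)],
   where [rho - rho sigma rho >= 0] and [K^* K = a rho^2 + (1 - a) >= 1 - a].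
   Factor [sigma = S^* S] with [S S^* = diag s] and put [G = K S^*]. Then
     [E(rho) >= G G^*]   and   [G^* G = S K^* K S^* >= (1 - a) diag s].
   The functional [A |-> Tr A * H(A / Tr A)] depends only on the spectrum, is monotone in the
   Loewner order (Klein's inequality), homogeneous, and agrees on [G G^*] and [G^* G]. Hence
   [H(E(rho)) >= (1 - a) H(sigma)], while the averaged output has entropy at most [log d]. *)

Set Implicit Arguments.
Unset Strict Implicit.
Unset Printing Implicit Defensive.
Import Order.TTheory GRing.Theory Num.Theory.
Local Open Scope ring_scope.
Local Open Scope complex_scope.
Local Open Scope sesquilinear_scope.


(** * Entropy inequalities for nonnegative real vectors *)

Section ClassicalEntropy.
Variables (R : realType) (d : nat).
Implicit Types x y : 'I_d -> R.

(* Homogeneous of degree one: [(sum x) * H(x / sum x)]. *)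
Definition hentropy x : R :=
  \sum_i x i * (ln (\sum_i x i) - ln (x i)).

Lemma ln_ge_1BV (t : R) : 0 < t -> 1 - t^-1 <= ln t.
Proof.
move=> t0; have := @le_ln1Dx R (t^-1 - 1).
by rewrite [1 + _]addrC subrK lnV ?posrE// ltrBrDl subrr invr_gt0 => /(_ t0); lra.
Qed.

(** This is [ln_ge_1BV] at [t = u / v], multiplied by [u]. Summed over eigenvalues, its left side is
    designed to cancel. *)
Lemma klein_scalar (u v : R) : 0 <= u -> 0 < v -> u - v <= u * (ln u - ln v).
Proof.
rewrite le_eqVlt => /orP[/eqP<- v0|u0 v0]; first by rewrite mul0r; lra.
have uv0 : 0 < u / v by rewrite divr_gt0.
have := ln_ge_1BV uv0; rewrite ln_div ?posrE// => h.
have -> : u - v = u * (1 - (u / v)^-1).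
  by field; rewrite !gt_eqF.
by rewrite ler_wpM2l// ltW.
Qed.

Lemma hentropy1 x : \sum_i x i = 1 -> hentropy x = - \sum_i x i * ln (x i).
Proof.
move=> x1; rewrite /hentropy x1 ln1 -sumrN.
by apply: eq_bigr => i _; rewrite sub0r mulrN.
Qed.

Lemma hentropyZ (c : R) x : 0 <= c -> (forall i, 0 <= x i) ->
  hentropy (fun i => c * x i) = c * hentropy x.
Proof.
move=> c0 x0; rewrite /hentropy !mulr_sumr; apply: eq_bigr => i _.
(* The logarithm of a product splits only for positive factors; when [c] or [x i] is zero the
   summand vanishes on both sides. *)
move: c0; rewrite le_eqVlt => /orP[/eqP<-|c0]; first by rewrite !mul0r.
have := x0 i; rewrite le_eqVlt => /orP[/eqP<-|xi0]; first by rewrite !mulr0 !mul0r mulr0.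
have s0 : 0 < \sum_i x i by rewrite (bigD1 i)//= ltr_pwDl// sumr_ge0.
rewrite -mulr_sumr !lnM ?posrE//; ring.
Qed.

(** Klein's inequality against the uniform distribution: the linear terms [x i - d^-1] sum to
    zero. *)
Lemma hentropy_le_ln x : (0 < d)%N -> (forall i, 0 <= x i) -> \sum_i x i = 1 ->
  hentropy x <= ln d%:R.
Proof.
move=> d0 x0 x1; have dR : 0 < d%:R :> R by rewrite ltr0n.
rewrite hentropy1// -subr_ge0 opprK -[ln d%:R]mul1r -{1}x1 mulr_suml -big_split/=.
have e0 : \sum_(i < d) (x i - d%:R^-1) = 0 :> R.
  rewrite big_split/= x1 sumrN sumr_const card_ord -[_ *+ d]mulr_natr mulVf ?subrr//.
  by rewrite gt_eqF.
rewrite -[leLHS]e0; apply: ler_sum => i _.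
have := @klein_scalar (x i) d%:R^-1 (x0 i); rewrite invr_gt0 lnV ?posrE//.
by move=> /(_ dR); lra.
Qed.

(* Klein's inequality read in two eigenbases: [w i j] is the squared modulus of the overlap of
   the [i]-th and [j]-th eigenvectors. *)
Lemma hentropy_le (w : 'I_d -> 'I_d -> R) x y :
  (forall i j, 0 <= w i j) ->
  (forall i, \sum_j w i j = 1) -> (forall j, \sum_i w i j = 1) ->
  (forall i, 0 <= x i) -> (forall j, \sum_i w i j * x i <= y j) ->
  hentropy x <= hentropy y.
Proof.
move=> w0 w1 w1' x0 xy.
have wx0 i j : 0 <= w i j * x i by rewrite mulr_ge0.
have y0 j : 0 <= y j by apply: le_trans (xy j); rewrite sumr_ge0.
have wxy i j : w i j * x i <= y j.
  by apply: le_trans (xy j); rewrite (bigD1 i)//= lerDl sumr_ge0.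
set a := \sum_i x i; set b := \sum_i y i.
have yb j : y j <= b by rewrite /b (bigD1 j)//= lerDl sumr_ge0.
have a0 : 0 <= a by rewrite sumr_ge0.
have xE (f : 'I_d -> R) : \sum_i x i * f i = \sum_i \sum_j w i j * (x i * f i).
  by apply: eq_bigr => i _; rewrite -mulr_suml w1 mul1r.
have ab : a <= b.
  have := xE (fun=> 1); under eq_bigr do rewrite mulr1.
  rewrite -/a => ->; rewrite exchange_big/=; apply: ler_sum => j _.
  by apply: le_trans (xy j); apply: ler_sum => i _; rewrite mulr1.
(* Since [y j <= b], the factor [ln b - ln (y j)] is nonnegative when [y j > 0], so its coefficient
   may be lowered from [y j] to the weighted sum of [x]. When [y j = 0] that sum is zero as well. *)
have yF : \sum_j \sum_i w i j * x i * (ln b - ln (y j)) <= hentropy y.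
  rewrite /hentropy -/b; apply: ler_sum => j _; rewrite -mulr_suml.
  have := y0 j; rewrite le_eqVlt => /orP[/eqP yj|yj].
    have -> : \sum_i w i j * x i = 0.
      by apply/eqP; rewrite eq_le sumr_ge0// andbT; apply: le_trans (xy j) _; rewrite -yj.
    by rewrite -yj !mul0r.
  rewrite ler_wpM2r// subr_ge0 ler_ln ?posrE//; exact: lt_le_trans yj (yb j).
apply: le_trans yF; rewrite /hentropy -/a xE [leRHS]exchange_big/= -subr_ge0.
have [a00|an0] := eqVneq a 0.
  rewrite -sumrB sumr_ge0// => i _; rewrite -sumrB sumr_ge0// => j _.
  have -> : x i = 0.
    by apply/eqP; rewrite eq_le x0 andbT -a00 /a (bigD1 i)//= lerDl sumr_ge0.
  by rewrite mulr0 !mul0r mulr0 subrr.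
have {an0}a0 : 0 < a by rewrite lt_def an0.
have b0 : 0 < b by exact: lt_le_trans ab.
(* Rescaling [y] to total mass [a] gives the reference values [a * y j / b]; as [w] is doubly
   stochastic, the linear terms of Klein's inequality then cancel. *)
have e0 : \sum_i \sum_j w i j * (x i - a * y j / b) = 0 :> R.
  under eq_bigr do under eq_bigr do rewrite mulrBr.
  under eq_bigr do rewrite sumrB -mulr_suml w1 mul1r.
  rewrite sumrB -/a exchange_big/=.
  under eq_bigr do rewrite -mulr_suml w1' mul1r.
  by rewrite -mulr_suml -mulr_sumr -/b mulfK ?subrr// gt_eqF.
rewrite -[leLHS]e0 -sumrB; apply: ler_sum => i _; rewrite -sumrB; apply: ler_sum => j _.
have z : 0 <= a * y j / b by rewrite divr_ge0 ?mulr_ge0// ltW.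
(* Where the weight [w i j * x i] vanishes, a nonpositive linear term remains. Elsewhere [y j] is at
   least this weight, hence positive, and the logarithms split. *)
have [wx|wx] := eqVneq (w i j * x i) 0.
  rewrite wx mul0r mulrA wx mul0r subrr mulrBr wx sub0r oppr_le0 mulr_ge0//.
have {wx}wx : 0 < w i j * x i by rewrite lt_def wx wx0.
have yj : 0 < y j by exact: lt_le_trans (wxy i j).
have {}z : 0 < a * y j / b by rewrite divr_gt0 ?mulr_gt0.
apply: le_trans (ler_wpM2l (w0 i j) (klein_scalar (x0 i) z)) _.
by rewrite ln_div ?posrE ?mulr_gt0// lnM ?posrE// le_eqVlt; apply/orP; left; apply/eqP; ring.
Qed.

(* [w i j] is the squared modulus of an entry of a matrix intertwining the diagonals [x] and
   [y]: it vanishes unless [x i = y j]. *)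
Lemma hentropy_swap (w : 'I_d -> 'I_d -> R) x y :
  (forall i, \sum_j w i j = x i) -> (forall j, \sum_i w i j = y j) ->
  (forall i j, w i j != 0 -> x i = y j) ->
  hentropy x = hentropy y.
Proof.
move=> wx wy xy; rewrite /hentropy.
have -> : \sum_i x i = \sum_i y i.
  by under eq_bigr do rewrite -wx; rewrite exchange_big; apply: eq_bigr => j _; rewrite wy.
set s := \sum_i y i.
(* Each [x i] is spread over row [i] of [w]; after exchanging the sums, column [j] collects [y j],
   and [x i = y j] wherever the weight is nonzero. *)
transitivity (\sum_i \sum_j w i j * (ln s - ln (x i))).
  by apply: eq_bigr => i _; rewrite -mulr_suml wx.
rewrite exchange_big; apply: eq_bigr => j _; rewrite -[X in X * _](wy j) mulr_suml.
apply: eq_bigr => i _; have [->|/xy <-//] := eqVneq (w i j) 0.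
by rewrite !mul0r.
Qed.

End ClassicalEntropy.


(** * Adjoints, real diagonal matrices and squared moduli *)

Section Adjoint.
Variable R : realType.
Local Notation C := R[i].

Lemma adjmxM m n p (A : 'M[C]_(m, n)) (B : 'M[C]_(n, p)) :
  (A *m B)^t* = B^t* *m A^t*.
Proof. by rewrite trmx_mul map_mxM. Qed.

Lemma adjmxD m n (A B : 'M[C]_(m, n)) : (A + B)^t* = A^t* + B^t*.
Proof. by rewrite linearD map_mxD. Qed.

Lemma adjmxZ m n (c : C) (A : 'M[C]_(m, n)) : (c *: A)^t* = c^* *: A^t*.
Proof. by rewrite linearZ map_mxZ. Qed.

Lemma conjC_real (x : R) : Num.conj (x%:C) = x%:C.
Proof. by rewrite conj_Creal// complex_real. Qed.

Lemma hermsymmxP n (A : 'M[C]_n) : reflect (A^t* = A) (A \is hermsymmx).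
Proof.
apply: (iffP (is_hermitianmxP _ _ _)); rewrite expr0 scale1r; exact: esym.
Qed.

Definition realdiag n (x : 'I_n -> R) : 'M[C]_n := diag_mx (\row_i (x i)%:C).

Lemma adjmx_realdiag n (x : 'I_n -> R) : (realdiag x)^t* = realdiag x.
Proof.
rewrite /realdiag tr_diag_mx map_diag_mx; congr diag_mx.
by apply/rowP => i; rewrite !mxE; exact: conjC_real.
Qed.

Lemma realdiagM n (x y : 'I_n -> R) :
  realdiag x *m realdiag y = realdiag (fun i => x i * y i).
Proof.
rewrite /realdiag mulmx_diag; congr diag_mx.
by apply/rowP => i; rewrite !mxE rmorphM.
Qed.

Lemma realdiagB n (x y : 'I_n -> R) :
  realdiag x - realdiag y = realdiag (fun i => x i - y i).
Proof.
rewrite /realdiag -raddfB; congr diag_mx.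
by apply/rowP => i; rewrite !mxE rmorphB.
Qed.

Lemma realdiag1 n : realdiag (fun _ : 'I_n => 1) = 1%:M.
Proof. by rewrite -diag_const_mx; congr diag_mx; apply/rowP => i; rewrite !mxE. Qed.

Lemma realdiagZ n (c : R) (x : 'I_n -> R) :
  c%:C *: realdiag x = realdiag (fun i => c * x i).
Proof.
rewrite /realdiag -linearZ; congr diag_mx.
by apply/rowP => i; rewrite !mxE rmorphM.
Qed.

Lemma tr_realdiag n (x : 'I_n -> R) : \tr (realdiag x) = (\sum_i x i)%:C.
Proof.
rewrite /realdiag mxtrace_diag rmorph_sum.
by apply: eq_bigr => i _; rewrite mxE.
Qed.

(** Valued in [R] rather than [C], so that it can serve as a weight in [hentropy_le] and
    [hentropy_swap]. *)
Definition sqmod (z : C) : R := (complex.Re z) ^+ 2 + (complex.Im z) ^+ 2.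

Lemma sqmodE z : (sqmod z)%:C = z * z^*.
Proof. by rewrite add_Re2_Im2 normCK. Qed.

Lemma sqmod_ge0 z : 0 <= sqmod z.
Proof. by rewrite addr_ge0// sqr_ge0. Qed.

Lemma sqmod_eq0 z : (sqmod z == 0) = (z == 0).
Proof.
have /inj_eq <- := @complexI R; rewrite sqmodE.
by rewrite mulf_eq0 conjC_eq0 orbb.
Qed.

Lemma diag_conj_realdiag m n (U : 'M[C]_(m, n)) (x : 'I_n -> R) j :
  (U *m realdiag x *m U^t*) j j = (\sum_i sqmod (U j i) * x i)%:C.
Proof.
rewrite mxE rmorph_sum; apply: eq_bigr => i _.
rewrite mul_mx_diag !mxE rmorphM/= sqmodE; ring.
Qed.

Lemma sqmod_row m n (U : 'M[C]_(m, n)) i :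
  (\sum_j sqmod (U i j))%:C = (U *m U^t*) i i.
Proof.
by rewrite mxE rmorph_sum; apply: eq_bigr => j _; rewrite /= sqmodE !mxE.
Qed.

Lemma sqmod_col m n (U : 'M[C]_(m, n)) j :
  (\sum_i sqmod (U i j))%:C = (U^t* *m U) j j.
Proof.
by rewrite mxE rmorph_sum; apply: eq_bigr => i _; rewrite /= sqmodE !mxE mulrC.
Qed.

End Adjoint.

(** * Unitary changes of basis for Gram matrices *)

Section Unitary.
Variables (C : numClosedFieldType) (n : nat).
Implicit Types P Q G A : 'M[C]_n.

Lemma unitary_mulVt P : P \is unitarymx -> P^t* *m P = 1%:M.
Proof. by rewrite -trmxC_unitary => /unitarymxP; rewrite trmxCK. Qed.

Lemma unitary_mul_adj P Q : P \is unitarymx -> Q \is unitarymx ->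
  Q *m P^t* \is unitarymx.
Proof. by move=> uP uQ; rewrite mul_unitarymx// trmxC_unitary. Qed.

Lemma mul_gram_unitary P Q G : Q \is unitarymx ->
  (P *m G *m Q^t*) *m (P *m G *m Q^t*)^t* = P *m (G *m G^t*) *m P^t*.
Proof.
move=> /unitary_mulVt QQ; rewrite !trmx_mul !map_mxM/= trmxCK.
by rewrite !mulmxA -[_ *m Q^t* *m Q]mulmxA QQ mulmx1.
Qed.

Lemma gram_mul_unitary P Q G : P \is unitarymx ->
  (P *m G *m Q^t*)^t* *m (P *m G *m Q^t*) = Q *m (G^t* *m G) *m Q^t*.
Proof.
move=> /unitary_mulVt PP; rewrite !trmx_mul !map_mxM/= trmxCK.
by rewrite !mulmxA -[_ *m P^t* *m P]mulmxA PP mulmx1.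
Qed.

End Unitary.

(** * Positive semidefinite matrices, their spectra and the matrix forms of the entropy
    inequalities *)

Section Psd.
Variable R : realType.
Local Notation C := R[i].

Lemma psdmxD n (A B : 'M[C]_n) : psdmx A -> psdmx B -> psdmx (A + B).
Proof.
move=> [/hermsymmxP hA A0] [/hermsymmxP hB B0]; split.
  by apply/hermsymmxP; rewrite adjmxD hA hB.
by move=> v; rewrite mulmxDr mulmxDl mxE addr_ge0.
Qed.

Lemma psdmxZ n (c : R) (A : 'M[C]_n) : 0 <= c -> psdmx A -> psdmx (c%:C *: A).
Proof.
move=> c0 [/hermsymmxP hA A0]; split.
  by apply/hermsymmxP; rewrite adjmxZ conjC_real hA.
by move=> v; rewrite -scalemxAr -scalemxAl mxE mulr_ge0// ler0c.
Qed.

Lemma psdmx_conj m n (X : 'M[C]_(m, n)) (A : 'M[C]_n) :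
  psdmx A -> psdmx (X *m A *m X^t*).
Proof.
move=> [/hermsymmxP hA A0]; split.
  by apply/hermsymmxP; rewrite !adjmxM hA trmxCK mulmxA.
by move=> v; have := A0 (X^t* *m v); rewrite adjmxM trmxCK !mulmxA.
Qed.

Lemma psdmx_realdiag n (x : 'I_n -> R) : (forall i, 0 <= x i) -> psdmx (realdiag x).
Proof.
move=> x0; split; first by apply/hermsymmxP; rewrite adjmx_realdiag.
move=> v; rewrite -{2}[v]trmxCK diag_conj_realdiag ler0c sumr_ge0// => i _.
by rewrite mulr_ge0// sqmod_ge0.
Qed.

Lemma psdmx1 n : psdmx (1%:M : 'M[C]_n).
Proof. by rewrite -realdiag1; apply: psdmx_realdiag. Qed.

Lemma psdmx0 n : psdmx (0 : 'M[C]_n).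
Proof.
by rewrite -[0](scale0r 1%:M) -[0](rmorph0 (real_complex R)); apply/psdmxZ/psdmx1.
Qed.

Lemma psdmx_sum n (I : Type) (r : seq I) (P : pred I) (F : I -> 'M[C]_n) :
  (forall i, P i -> psdmx (F i)) -> psdmx (\sum_(i <- r | P i) F i).
Proof. exact: (big_ind (@psdmx R n) (psdmx0 n) (@psdmxD n)). Qed.

Lemma psdmx_gram m n (X : 'M[C]_(m, n)) : psdmx (X *m X^t*).
Proof. by rewrite -[X in X *m _]mulmx1; apply/psdmx_conj/psdmx1. Qed.

Lemma psdmx_diag n (A : 'M[C]_n) i : psdmx A -> 0 <= A i i.
Proof.
move=> [_ /(_ (delta_mx i 0))]; rewrite trmx_delta map_delta_mx -rowE.
by rewrite -colE !mxE.
Qed.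

(** Eigenbasis and order of eigenvalues are left free, so a matrix that is already diagonal can be
    paired with the identity instead of its [spectralmx]. *)
Definition diagonalizes n (P : 'M[C]_n) (x : 'I_n -> R) (A : 'M[C]_n) : Prop :=
  P \is unitarymx /\ A = P^t* *m realdiag x *m P.

Lemma diagonalizesE n (P : 'M[C]_n) x A :
  diagonalizes P x A -> P *m A *m P^t* = realdiag x.
Proof.
move=> [/[dup] /unitarymxP PP _ ->].
by rewrite !mulmxA PP mul1mx -mulmxA PP mulmx1.
Qed.

Lemma diagonalizes_psd n (P : 'M[C]_n) x A :
  diagonalizes P x A -> psdmx A -> forall i, 0 <= x i.
Proof.
move=> /diagonalizesE PA /(psdmx_conj P) + i; rewrite PA => /(psdmx_diag i).
by rewrite !mxE eqxx mulr1n ler0c.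
Qed.

Lemma diagonalizes_tr n (P : 'M[C]_n) x A :
  diagonalizes P x A -> \tr A = (\sum_i x i)%:C.
Proof.
by move=> [uP ->]; rewrite mxtrace_mulC mulmxA (unitarymxP uP) mul1mx tr_realdiag.
Qed.

Definition spectrum n (A : 'M[C]_n) (i : 'I_n) : R := complex.Re (spectral_diag A 0 i).

Lemma spectrumP n (A : 'M[C]_n) : A \is hermsymmx ->
  diagonalizes (spectralmx A) (spectrum A) A.
Proof.
move=> hA; have uP := spectral_unitarymx A; split=> //.
have dE : diag_mx (spectral_diag A) = realdiag (spectrum A).
  congr diag_mx; apply/rowP => i; rewrite mxE RRe_real//.
  by have /mxOverP := hermitian_spectral_diag_real hA.
by rewrite -(invmx_unitary uP) -dE; exact: (orthomx_spectralP (hermitian_normalmx hA)).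
Qed.

Lemma tr_conj_realdiagM n (P : 'M[C]_n) (x y : 'I_n -> R) : P \is unitarymx ->
  \tr (P^t* *m realdiag x *m P *m (P^t* *m realdiag y *m P)) = (\sum_i x i * y i)%:C.
Proof.
move=> /unitarymxP; move: (P^t*) => Q PQ.
have -> : Q *m realdiag x *m P *m (Q *m realdiag y *m P)
    = Q *m (realdiag x *m (P *m Q) *m realdiag y *m P) by rewrite !mulmxA.
by rewrite PQ mulmx1 realdiagM mxtrace_mulC -mulmxA PQ mulmx1 tr_realdiag.
Qed.

Lemma entropyE n (A : 'M[C]_n) : A \is hermsymmx ->
  entropy A = - \sum_i spectrum A i * ln (spectrum A i).
Proof.
move=> hA; have [uP AE] := spectrumP hA; rewrite /entropy; congr (- _).
pose L := realdiag (fun i => ln (spectrum A i)).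
have lE : lnmx A = (spectralmx A)^t* *m L *m spectralmx A.
  rewrite -(invmx_unitary uP) /lnmx.
  suff -> : map_mx (fun z : C => (ln (complex.Re z))%:C) (spectral_diag A)
    = \row_i (ln (spectrum A i))%:C by [].
  by apply/rowP => i; rewrite !mxE.
by rewrite lE [X in \tr (X *m _)]AE tr_conj_realdiagM.
Qed.

(** The weights are the squared moduli of the entries of [U = Q P^*], doubly stochastic by
    unitarity. The diagonal of [Q (B - A) Q^*] is nonnegative, which bounds the weighted sums of [x]
    by [y]. *)
Lemma hentropy_loewner n (P Q A B : 'M[C]_n) x y :
  diagonalizes P x A -> diagonalizes Q y B -> psdmx A -> psdmx (B - A) ->
  hentropy x <= hentropy y.
Proof.
move=> dA dB A0 BA.
have [[uP AE] [uQ BE]] := (dA, dB).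
have := unitary_mul_adj uP uQ; set U := Q *m _ => uU.
apply: (@hentropy_le _ _ (fun i j => sqmod (U j i))).
- by move=> i j; exact: sqmod_ge0.
- by move=> i; apply: (@complexI R); rewrite sqmod_col (unitary_mulVt uU) mxE eqxx.
- by move=> j; apply: (@complexI R); rewrite sqmod_row (unitarymxP uU) mxE eqxx.
- exact: diagonalizes_psd dA A0.
move=> j; have /(psdmx_diag j) := psdmx_conj Q BA.
rewrite mulmxBr mulmxBl (diagonalizesE dB) AE.
have -> : Q *m (P^t* *m realdiag x *m P) *m Q^t* = U *m realdiag x *m U^t*.
  by rewrite /U adjmxM trmxCK !mulmxA.
rewrite mxE [X in _ + X]mxE diag_conj_realdiag !mxE eqxx mulr1n -rmorphB ler0c.
by rewrite subr_ge0.
Qed.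

(** In the two eigenbases [G] becomes [H = P G Q^*], with [H H^*] and [H^* H] diagonal.
    Associativity of [H H^* H] makes [H] intertwine the two diagonals, so no matching of
    multiplicities is required. *)
Lemma hentropy_gram n (P Q G : 'M[C]_n) x y :
  diagonalizes P x (G *m G^t*) -> diagonalizes Q y (G^t* *m G) ->
  hentropy x = hentropy y.
Proof.
move=> dA dB; pose H := P *m G *m Q^t*.
have [[uP _] [uQ _]] := (dA, dB).
have Hx : H *m H^t* = realdiag x by exact: etrans (mul_gram_unitary P G uQ) (diagonalizesE dA).
have Hy : H^t* *m H = realdiag y by exact: etrans (gram_mul_unitary Q G uP) (diagonalizesE dB).
clearbody H.
apply: (@hentropy_swap _ _ (fun i j => sqmod (H i j))).
- by move=> i; apply: (@complexI R); rewrite sqmod_row Hx !mxE eqxx.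
- by move=> j; apply: (@complexI R); rewrite sqmod_col Hy !mxE eqxx.
move=> i j; rewrite sqmod_eq0 => Hij; apply: (@complexI R).
have /matrixP/(_ i j) : realdiag x *m H = H *m realdiag y by rewrite -Hx -Hy mulmxA.
by rewrite mul_diag_mx mul_mx_diag !mxE mulrC => /(mulfI Hij).
Qed.

(** The factor is the square root of the diagonal times the eigenbasis, not the Hermitian square
    root: this makes [S S^*] diagonal. *)
Lemma psd_factor n (A : 'M[C]_n) : psdmx A ->
  exists S : 'M[C]_n, A = S^t* *m S /\ S *m S^t* = realdiag (spectrum A).
Proof.
move=> A0; have dA := spectrumP A0.1; have s0 := diagonalizes_psd dA A0.
exists (realdiag (fun i => Num.sqrt (spectrum A i)) *m spectralmx A).
have sE : realdiag (fun i => Num.sqrt (spectrum A i)) *m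
    realdiag (fun i => Num.sqrt (spectrum A i)) = realdiag (spectrum A).
  rewrite realdiagM; congr diag_mx; apply/rowP => i; rewrite !mxE.
  by rewrite -expr2 sqr_sqrtr.
rewrite adjmxM adjmx_realdiag; split.
  by rewrite !mulmxA -[_ *m _ *m realdiag _]mulmxA sE; exact: dA.2.
by rewrite !mulmxA -[_ *m _ *m _^t*]mulmxA (unitarymxP dA.1) mulmx1 sE.
Qed.

End Psd.


(** * Products of affine matrix expressions with abstract scalars *)

Section Expansion.
Variables (F : comNzRingType) (n : nat).
Implicit Types (A B : 'M[F]_n) (u w z : F).

Lemma affine_sandwich u w z A B :
  (u *: A + w%:M) *m B *m (u *: A + z%:M) =
  (u * u) *: (A *m B *m A) + (u * z) *: (A *m B) + (u * w) *: (B *m A) + (w * z) *: B.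
Proof.
rewrite !(mulmxDl, mulmxDr) -!(scalemxAl, scalemxAr) !(mul_scalar_mx, mul_mx_scalar).
rewrite -!(scalemxAl, scalemxAr) !scalerA.
move: (A *m B *m A) (A *m B) (B *m A) => X Y Z.
apply/matrixP => i j; rewrite !mxE; ring.
Qed.

Lemma affine_mul_opp u w A :
  (u *: A + (- w)%:M) *m (u *: A + w%:M) = (u * u) *: (A *m A) + (- (w * w))%:M.
Proof.
rewrite !(mulmxDl, mulmxDr) -!(scalemxAl, scalemxAr) !(mul_scalar_mx, mul_mx_scalar).
rewrite !scalerA ?scale_scalar_mx.
move: (A *m A) => X.
apply/matrixP => i j; rewrite !mxE; ring.
Qed.
End Expansion.

(** * Positivity and output entropy of the partial swap channel *)

Section PartialSwap.
Variables (R : realType) (d : nat) (a : R).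
Hypothesis a01 : 0 <= a <= 1.
Local Notation C := R[i].
Implicit Types rho sigma : 'M[C]_d.

Lemma density_spectrum rho : density rho ->
  (forall i, 0 <= spectrum rho i) /\ \sum_i spectrum rho i = 1.
Proof.
move=> [r0 tr1]; have dr := spectrumP r0.1; split; first exact: diagonalizes_psd dr r0.
by apply: (@complexI R); rewrite -(diagonalizes_tr dr).
Qed.

Lemma density_entropy rho : density rho -> entropy rho = hentropy (spectrum rho).
Proof.
by move=> hr; rewrite (hentropy1 (density_spectrum hr).2) (entropyE hr.1.1).
Qed.

Lemma density_le1 rho : density rho -> psdmx (1%:M - rho).
Proof.
move=> hr; have [r0 r1] := density_spectrum hr; have [uP rE] := spectrumP hr.1.1.
have -> : 1%:M - rho =
    (spectralmx rho)^t* *m realdiag (fun i => 1 - spectrum rho i) *m (spectralmx rho)^t*^t*.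
  rewrite trmxCK -realdiagB mulmxBr mulmxBl realdiag1 mulmx1 (unitary_mulVt uP).
  by congr (_ - _).
apply/psdmx_conj/psdmx_realdiag => i.
by rewrite subr_ge0 -r1 (bigD1 i)//= lerDl sumr_ge0.
Qed.

Lemma psdmx_sub_sandwich rho sigma :
  density rho -> density sigma -> psdmx (rho - rho *m sigma *m rho).
Proof.
move=> hr hs; have rH : rho^t* = rho by apply/hermsymmxP; exact: hr.1.1.
have [S [rE SE]] := psd_factor hr.1; have [r0 r1] := density_spectrum hr.
have -> : rho - rho *m sigma *m rho =
    S^t* *m realdiag (fun i => 1 - spectrum rho i) *m S^t*^t*
      + rho *m (1%:M - sigma) *m rho^t*.
  rewrite trmxCK rH -realdiagB realdiag1 -SE !mulmxBr !mulmxBl !mulmx1.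
  rewrite !mulmxA -rE -[_ *m S^t* *m S]mulmxA -rE.
  by rewrite addrA subrK.
apply: psdmxD; last exact/psdmx_conj/density_le1.
apply/psdmx_conj/psdmx_realdiag => i.
by rewrite subr_ge0 -r1 (bigD1 i)//= lerDl sumr_ge0.
Qed.

Definition swap_kraus rho : 'M[C]_d :=
  (Num.sqrt a)%:C *: rho + ((Num.sqrt (1 - a))%:C * 'i%C)%:M.

Lemma adj_swap_kraus rho : rho \is hermsymmx ->
  (swap_kraus rho)^t* = (Num.sqrt a)%:C *: rho + (- ((Num.sqrt (1 - a))%:C * 'i%C))%:M.
Proof.
move=> /hermsymmxP rH; rewrite adjmxD adjmxZ rH conjC_real tr_scalar_mx map_scalar_mx/=.
by rewrite rmorphM/= conjC_real complexiE conjCi mulrN.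
Qed.

Let a0 : 0 <= a. Proof. by case/andP: a01. Qed.
Let b0 : 0 <= 1 - a. Proof. by case/andP: a01; rewrite subr_ge0. Qed.

Let sqrta : (Num.sqrt a)%:C * (Num.sqrt a)%:C = a%:C.
Proof. by rewrite -rmorphM -expr2 sqr_sqrtr. Qed.

Let sqrtbi : ((Num.sqrt (1 - a))%:C * 'i%C) * ((Num.sqrt (1 - a))%:C * 'i%C) = - (1 - a)%:C.
Proof. by rewrite mulrACA -rmorphM -!expr2 sqr_sqrtr// sqr_i mulrN1. Qed.

(** The cross terms of [K sigma K^*] produce exactly the commutator; its quadratic term
    [a rho sigma rho] is cancelled by the correction, which also supplies [a rho]. *)
Lemma partial_swapE rho sigma : rho \is hermsymmx ->
  partial_swap a sigma rho =
  swap_kraus rho *m sigma *m (swap_kraus rho)^t* + a%:C *: (rho - rho *m sigma *m rho).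
Proof.
move=> rH; rewrite adj_swap_kraus// affine_sandwich mulrN sqrta mulrN sqrtbi opprK.
rewrite /partial_swap /commutator sqrtrM// rmorphM/= -mulrA.
move: (_ * (_ * 'i%C)) (rho *m sigma *m rho) (rho *m sigma) (sigma *m rho) => c X Y Z.
by apply/matrixP => i j; rewrite !mxE; ring.
Qed.

(** The scalar part of [K] is purely imaginary and [rho] is Hermitian, so the cross terms cancel. *)
Lemma swap_kraus_gram rho : rho \is hermsymmx ->
  (swap_kraus rho)^t* *m swap_kraus rho = a%:C *: (rho *m rho) + (1 - a)%:C%:M.
Proof.
by move=> rH; rewrite adj_swap_kraus// affine_mul_opp sqrta sqrtbi opprK.
Qed.

Lemma partial_swap_density rho sigma :
  density rho -> density sigma -> density (partial_swap a sigma rho).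
Proof.
move=> hr hs; split.
  rewrite (partial_swapE _ hr.1.1); apply: psdmxD; first exact: psdmx_conj hs.1.
  exact/psdmxZ/psdmx_sub_sandwich.
have tr0 : \tr (commutator rho sigma) = 0.
  by rewrite /commutator raddfB/= mxtrace_mulC subrr.
rewrite /partial_swap raddfB/= mxtraceD !mxtraceZ tr0 mulr0 hr.2 hs.2 !mulr1 subr0.
by rewrite -rmorphD/= addrC subrK.
Qed.

Lemma partial_swap_entropy rho sigma : density rho -> density sigma ->
  (1 - a) * entropy sigma <= entropy (partial_swap a sigma rho).
Proof.
move=> hr hs; have hM := partial_swap_density hr hs.
have rH : rho^t* = rho by apply/hermsymmxP; exact: hr.1.1.
have [S [sE SE]] := psd_factor hs.1.
pose K := swap_kraus rho; pose G := K *m S^t*.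
have GG : G *m G^t* = K *m sigma *m K^t* by rewrite adjmxM trmxCK sE !mulmxA.
have GG' : G^t* *m G = a%:C *: ((S *m rho) *m (S *m rho)^t*)
    + (1 - a)%:C *: realdiag (spectrum sigma).
  have -> : G^t* *m G = S *m (K^t* *m K) *m S^t* by rewrite adjmxM trmxCK !mulmxA.
  rewrite /K (swap_kraus_gram hr.1.1) mulmxDr mulmxDl adjmxM rH -SE.
  by rewrite mul_mx_scalar -!scalemxAr -!scalemxAl !mulmxA.
have p1 := psdmx_gram G.
have p2 : psdmx (G^t* *m G) by have := psdmx_gram (G^t*); rewrite trmxCK.
have h1 := spectrumP p1.1; have h2 := spectrumP p2.1; have hMd := spectrumP hM.1.1.
have [s0 s1] := density_spectrum hs.
have hd : diagonalizes 1%:M (fun i => (1 - a) * spectrum sigma i)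
    ((1 - a)%:C *: realdiag (spectrum sigma)).
  split; first by apply/unitarymxP; rewrite trmx1 map_mx1 mulmx1.
  by rewrite trmx1 map_mx1 mul1mx mulmx1 realdiagZ.
rewrite (density_entropy hs) (density_entropy hM) -hentropyZ//.
(* First comparison: [G^* G] exceeds [(1 - a) diag s] by [a (S rho) (S rho)^*]. *)
apply: (@le_trans _ _ (hentropy (spectrum (G^t* *m G)))).
  apply: (hentropy_loewner hd h2).
    exact/psdmxZ/psdmx_realdiag.
  by rewrite GG' addrK; exact/psdmxZ/psdmx_gram.
(* Second comparison, after passing to [G G^*]: the channel output exceeds it by
   [a (rho - rho sigma rho)]. *)
rewrite -(hentropy_gram h1 h2); apply: (hentropy_loewner h1 hMd p1).
rewrite GG /K (partial_swapE _ hr.1.1) [X in X - _]addrC addrK.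
exact/psdmxZ/psdmx_sub_sandwich.
Qed.

End PartialSwap.

(** * From output entropies to the Holevo capacity *)

Theorem mainTheorem6 (R : realType) (d : nat) (hd : (1 <= d)%N) (a : R)
    (ha : 0 <= a <= 1) (sigma : 'M[R[i]]_d) (hsigma : density sigma) :
  (holevo_capacity (partial_swap a sigma)
     <= (ln (d%:R : R) - (1 - a) * entropy sigma)%:E)%E.
Proof.
apply: ge_ereal_sup => _ [n [p [rho [[p0 p1 hrho] ->]]]].
have hE i := partial_swap_density ha (hrho i) hsigma.
have hM : density (\sum_(i < n) (p i)%:C *: partial_swap a sigma (rho i)).
  split; first by apply: psdmx_sum => i _; exact: psdmxZ (hE i).1.
  rewrite raddf_sum/=; under eq_bigr do rewrite mxtraceZ (hE _).2 mulr1.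
  by rewrite -rmorph_sum p1.
(* The two terms of the Holevo quantity are bounded separately: the entropy of the average from
   above, the average entropy from below. *)
rewrite lee_fin lerB//.
  have [m0 m1] := density_spectrum hM.
  by rewrite (density_entropy hM) hentropy_le_ln.
(* The constant [(1 - a) * entropy sigma] is distributed over the ensemble, whose probabilities sum
   to one. *)
rewrite -[leLHS]mul1r -{1}p1 mulr_suml; apply: ler_sum => i _.
by rewrite ler_wpM2l// partial_swap_entropy.
Qed.
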